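(* Let $d_I,d_O\in\mathbb N$, $a\in\mathbb R$, $b\in(a,\infty)$, let $\sigma\colon\mathbb R\to\mathbb R$ be locally Lipschitz continuous, let $\mu\colon\mathcal B([a,b]^{d_I})\to[0,\infty]$ be a finite measure, let $f\colon[a,b]^{d_I}\to\mathbb R^{d_O}$ be measurable, let $L\in\mathbb N$ and let $\ell=(\ell_0,\dots,\ell_L)\in\mathbb N^{L+1}$ satisfy $\ell_0=d_I$ and $\ell_L=d_O$. Let $\mathcal L_\ell\colon\mathbb R^{D_\ell}\to\mathbb R$ be the (real-valued) risk function of fully connected feedforward networks with architecture $\ell$ and activation $\sigma$, as defined in the context. Let $\theta\in\mathbb R^{D_\ell}$ satisfy $0\in(\partial_C\mathcal L_\ell)(\theta)$, where $\partial_C$ is the Clarke subdifferential. Then $$\mathcal L_\ell(\theta)\le\inf_{\xi\in\mathbb R^{d_O}}\int_{[a,b]^{d_I}}\|f(x)-\xi\|^2\,\mu(dx).$$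
   Context: For $L\in\mathbb N$, $\ell=(\ell_0,\dots,\ell_L)\in\mathbb N^{L+1}$ let $D_\ell=\sum_{k=1}^L\ell_k(\ell_{k-1}+1)$. For $\theta\in\mathbb R^{D_\ell}$ and $k\in\{1,\dots,L\}$ let $W^{\ell,k,\theta}\in\mathbb R^{\ell_k\times\ell_{k-1}}$ and $B^{\ell,k,\theta}\in\mathbb R^{\ell_k}$ have entries $W^{\ell,k,\theta}_{i,j}=\theta_{(i-1)\ell_{k-1}+j+s_k}$ and $B^{\ell,k,\theta}_i=\theta_{\ell_k\ell_{k-1}+i+s_k}$ with $s_k=\sum_{r=1}^{k-1}\ell_r(\ell_{r-1}+1)$. Define $\mathcal N^{\ell,k,\theta}\colon\mathbb R^{\ell_0}\to\mathbb R^{\ell_k}$ by $\mathcal N^{\ell,1,\theta}(x)=B^{\ell,1,\theta}+W^{\ell,1,\theta}x$ and $\mathcal N^{\ell,k+1,\theta}(x)=B^{\ell,k+1,\theta}+W^{\ell,k+1,\theta}\,\sigma(\mathcal N^{\ell,k,\theta}(x))$ for $k\in\{1,\dots,L-1\}$, with $\sigma$ applied componentwise. If $\ell_0=d_I$, $\ell_L=d_O$, then $\mathcal L_\ell(\theta)=\int_{[a,b]^{d_I}}\|\mathcal N^{\ell,L,\theta}(x)-f(x)\|^2\,\mu(dx)$, assumed to be real-valued (finite), where $\|\cdot\|$ is the Euclidean norm. Clarke subdifferential: for locally Lipschitz $g\colon\mathbb R^n\to\mathbb R$ and $x\in\mathbb R^n$, $(\partial_Cg)(x)$ is the convex hull of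 the set of all $y\in\mathbb R^n$ for which there is a sequence $(z_k)_{k\in\mathbb N}$ of points at which $g$ is differentiable with $z_k\to x$ and $\nabla g(z_k)\to y$. (Under the present hypotheses $\mathcal L_\ell$ is locally Lipschitz.) *)

(* Defs.v *)
From HB Require Import structures.
From mathcomp Require Import all_boot all_order all_algebra.
From mathcomp Require Import all_classical all_reals all_analysis.

Set Implicit Arguments.
Unset Strict Implicit.
Unset Printing Implicit Defensive.

Import Order.TTheory GRing.Theory Num.Theory.
Import numFieldNormedType.Exports.

Local Open Scope classical_set_scope.
Local Open Scope ring_scope.

(* R^n is 'cV[R]_n. The library norm on it is the max norm; it induces the
   usual topology, Borel sets and notion of differentiability, but the squared
   error below needs the Euclidean norm. *)
Definition enorm (R : realType) n (v : 'cV[R]_n) : R :=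
  Num.sqrt (\sum_i v i 0 ^+ 2).

Definition locally_lipschitz (R : realType) (f : R -> R) : Prop :=
  forall x : R, exists2 U : set R, nbhs x U & [lipschitz f y | y in U].

Notation borel T := (g_sigma_algebraType (@open T)).

Definition cube_set (R : realType) (a b : R) d : set 'cV[R]_d :=
  [set x | forall i, a <= x i 0 <= b].
Arguments cube_set {R} a b d.

(* [a, b]^d as a type with the subspace topology. The proof of [a < b] is there
   because measurable types have to be inhabited. *)
Definition cube (R : realType) (a b : R) (ab : a < b) d : Type :=
  cube_set a b d.

Section cube_instances.
Variables (R : realType) (a b : R) (ab : a < b) (d : nat).

Lemma const_in_cube : (const_mx a : 'cV[R]_d) \in cube_set a b d.
Proof. by apply/mem_set => i; rewrite mxE lexx ltW. Qed.

HB.instance Definition _ :=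
  Topological.copy (cube ab d) (set_type (cube_set a b d)).
HB.instance Definition _ :=
  isPointed.Build (cube ab d) 
    (exist (fun x => x \in cube_set a b d) (const_mx a) const_in_cube).

Definition cube_val (x : cube ab d) : 'cV[R]_d := set_val x.

End cube_instances.

Section clarke.
Variables (R : realType) (n : nat).
Implicit Types (g : 'cV[R]_n -> R) (x y : 'cV[R]_n).

Definition gradient g x : 'cV[R]_n := \col_i 'D_(delta_mx i 0) g x.

Definition convex_hull (A : set 'cV[R]_n) : set 'cV[R]_n :=
  smallest (@convex_set R 'cV[R]_n) A.

Definition limiting_gradients g x : set 'cV[R]_n :=
  [set y | exists z : nat -> 'cV[R]_n,
    [/\ forall k, differentiable g (z k), z @ \oo --> x &
        (fun k => gradient g (z k)) @ \oo --> y]].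

Definition clarke_subdiff g x : set 'cV[R]_n :=
  convex_hull (limiting_gradients g x).

End clarke.

Section network.
Variables (R : realType) (L : nat) (l : L.+1.-tuple nat).

Definition width (k : nat) : nat := nth 0%N l k.

(* s_k; layers are numbered from 1 as in the mathematical definition, whereas
   rows, columns and entries of the parameter vector are numbered from 0. *)
Definition offset (k : nat) : nat :=
  (\sum_(1 <= r < k) width r * (width r.-1).+1)%N.

Definition nparams : nat :=
  (\sum_(1 <= k < L.+1) width k * (width k.-1).+1)%N.

Definition weight_index (k i j : nat) : nat := (i * width k.-1 + j + offset k)%N.

Definition bias_index (k i : nat) : nat :=
  (width k * width k.-1 + i + offset k)%N.

Lemma offset_leq_nparams k : (1 <= k <= L)%N ->
  (offset k + width k * (width k.-1).+1 <= nparams)%N.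
Proof.
case/andP=> k1 kL.
rewrite /nparams (big_cat_nat (n := k.+1))//= big_nat_recr//=.
exact: leq_addr.
Qed.

Lemma weight_index_lt k i j : (1 <= k <= L)%N ->
  (i < width k)%N -> (j < width k.-1)%N -> (weight_index k i j < nparams)%N.
Proof.
move=> /offset_leq_nparams h iw jw; apply: leq_trans h.
rewrite /weight_index addnC ltn_add2l mulnS.
apply: (@leq_trans (i.+1 * width k.-1)%N).
  by rewrite mulSn addnC ltn_add2r.
by apply: leq_trans (leq_addl _ _); rewrite leq_mul2r iw orbT.
Qed.

Lemma bias_index_lt k i : (1 <= k <= L)%N ->
  (i < width k)%N -> (bias_index k i < nparams)%N.
Proof.
move=> /offset_leq_nparams h iw; apply: leq_trans h.
by rewrite /bias_index addnC ltn_add2l mulnS [ltnRHS]addnC ltn_add2l.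
Qed.

(* The default 0 is never used for 1 <= k <= L, see [weight_index_lt] and
   [bias_index_lt]. *)
Definition param (theta : 'cV[R]_nparams) (m : nat) : R :=
  if insub m is Some j then theta j 0 else 0.

Definition weight (theta : 'cV[R]_nparams) k : 'M[R]_(width k, width k.-1) :=
  \matrix_(i, j) param theta (weight_index k i j).

Definition bias (theta : 'cV[R]_nparams) k : 'cV[R]_(width k) :=
  \col_i param theta (bias_index k i).

(* N^{l,k,theta}; the value at k = 0 is the input, to which the activation is
   not applied. *)
Fixpoint net (sigma : R -> R) (theta : 'cV[R]_nparams)
    (x : 'cV[R]_(width 0)) (k : nat) : 'cV[R]_(width k) :=
  match k with
  | 0 => x
  | k'.+1 =>
      let y := net sigma theta x k' in
      bias theta k'.+1
        + weight theta k'.+1 *m (if k' == 0%N then y else map_mx sigma y)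
  end.

Definition realization (dI dO : nat) (hI : width 0 = dI) (hO : width L = dO)
    (sigma : R -> R) (theta : 'cV[R]_nparams) (x : 'cV[R]_dI) : 'cV[R]_dO :=
  castmx (hO, erefl 1%N)
    (net sigma theta (castmx (esym hI, erefl 1%N) x) L).

End network.

Section risk.
Variables (R : realType) (dI dO : nat) (a b : R) (ab : a < b).
Variable mu : {finite_measure set (borel (cube ab dI)) -> \bar R}.
Variables (f : cube ab dI -> 'cV[R]_dO) (sigma : R -> R).
Variables (L : nat) (l : L.+1.-tuple nat).
Variables (hI : width l 0 = dI) (hO : width l L = dO).

Definition erisk (theta : 'cV[R]_(nparams l)) : \bar R :=
  (\int[mu]_x
    (enorm (realization hI hO sigma theta (cube_val (x : cube ab dI)) - f x) ^+ 2)%:E)%E.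

(* The risk as a real number; it is only meaningful where [erisk] is finite. *)
Definition risk (theta : 'cV[R]_(nparams l)) : R := fine (erisk theta).

End risk.

(* Main.v *)
(* The output of the network is affine in the parameters of the last layer, so
   the risk is convex along every direction v that moves only these parameters,
   and each gradient of the risk satisfies the secant bound
   grad L(z) . v <= L(z + v) - L(z). As L is continuous (dominated convergence),
   the bound holds at theta for all limits of gradients, and then for their
   convex hull since it defines a half-space. For the zero element of the Clarke
   subdifferential and the v that turns the last layer of theta into zero
   weights with bias xi it reads L(theta) <= L(theta + v), and theta + v realizes
   the constant function xi. *)
Require Import Defs.
From mathcomp Require Import all_boot all_order all_algebra.
From mathcomp Require Import all_classical all_reals all_analysis.
From mathcomp Require Import measurable_realfun ring lra.

Import Order.TTheory GRing.Theory Num.Theory.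
Import numFieldNormedType.Exports.

Local Open Scope classical_set_scope.
Local Open Scope ring_scope.

Set Implicit Arguments.
Unset Strict Implicit.

(** * Directional derivatives, secants and limits of gradients *)

Lemma derive_gradient (R : realType) n (g : 'cV[R]_n -> R) (z v : 'cV[R]_n) :
  differentiable g z -> 'D_v g z = \sum_i v i 0 * gradient g z i 0.
Proof.
move=> dg; rewrite deriveE// [in LHS](matrix_sum_delta v) linear_sum.
apply: eq_bigr => i _; rewrite big_ord1 linearZ/= /gradient mxE deriveE//.
Qed.

(** For [0 < t <= 1] the hypothesis bounds the difference quotient at [t] by the full secant; let
    [t] tend to 0 from the right. *)
Lemma derive_le_secant (R : realType) n (g : 'cV[R]_n -> R) (z v : 'cV[R]_n) :
  differentiable g z ->
  (forall t, 0 <= t <= 1 -> g (z + t *: v) <= g z + t * (g (z + v) - g z)) ->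
  'D_v g z <= g (z + v) - g z.
Proof.
move=> dg cvx.
have dv : derivable g z v by exact: diff_derivable.
apply: (cvgr_to_le (cvg_dnbhs_at_right dv)).
near=> t; have t0 : 0 < t by near: t; exact: nbhs_right_gt.
rewrite /= /GRing.scale/= mulrC ler_pdivrMr// [leRHS]mulrC lerBlDl.
rewrite [t *: v + z]addrC; apply: cvx.
by rewrite ltW//=; near: t; exact: nbhs_right_le.
Unshelve. all: by end_near. Qed.

Lemma convex_halfspace (R : realType) n (v : 'cV[R]_n) (c : R) :
  convex_set [set y : 'cV[R]_n | \sum_i v i 0 * y i 0 <= c].
Proof.
move=> x y k; rewrite !inE/= => hx hy.
pose t : R := k%:num.
have -> : conv k x y =
  t *: (x : 'cV[R]_n) + (1 - t) *: (y : 'cV[R]_n) :> 'cV[R]_n by [].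
have t0 : 0 <= t by rewrite /t ge0.
have t1 : t <= 1 by rewrite /t le1.
rewrite (_ : \sum_i _ =
  t * (\sum_i v i 0 * x i 0) + (1 - t) * (\sum_i v i 0 * y i 0)); last first.
  rewrite !mulr_sumr -big_split/=; apply: eq_bigr => i _; rewrite !mxE; ring.
rewrite [leRHS](_ : _ = t * c + (1 - t) * c); last by ring.
by rewrite lerD// ler_wpM2l// subr_ge0.
Qed.

(* A secant bound on the directional derivative is a closed convex condition on
   the gradient, so it passes to limits of gradients and to their convex hull. *)
Lemma clarke_subdiff_le (R : realType) n (g : 'cV[R]_n -> R)
    (theta v y : 'cV[R]_n) :
  (forall w z, z @ \oo --> w -> g (z k) @[k --> \oo] --> g w) ->
  (forall z t, 0 <= t <= 1 ->
    g (z + t *: v) <= g z + t * (g (z + v) - g z)) ->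
  clarke_subdiff g theta y ->
  \sum_i v i 0 * y i 0 <= g (theta + v) - g theta.
Proof.
move=> gc cvx.
apply: (smallest_sub (@convex_halfspace R n v (g (theta + v) - g theta))).
move=> {}y [z [dg zt gy]] /=.
have hL : \sum_i v i 0 * gradient g (z k) i 0 @[k --> \oo] -->
    \sum_i v i 0 * y i 0.
  apply: cvg_big => [|i _]; first exact: add_continuous.
  apply: cvgM; first exact: cvg_cst.
  exact: (cvg_comp _ _ gy (@coord_continuous _ _ _ i 0 y)).
have hR : g (z k + v) - g (z k) @[k --> \oo] --> g (theta + v) - g theta.
  apply: cvgB; last exact: (gc _ z zt).
  by apply: (@gc _ (fun k => z k + v)); apply: cvgD => //; exact: cvg_cst.
apply: (ler_cvg_to hL hR); apply: nearW => k.
by rewrite -derive_gradient//; apply: derive_le_secant => // t; exact: cvx.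
Qed.

(** * Continuity, boundedness and Borel measurability *)

Lemma locally_lipschitz_continuous (R : realType) (s : R -> R) :
  locally_lipschitz s -> continuous s.
Proof.
move=> sl x; have [U Ux] := sl x.
move=> /pinfty_ex_gt0[M M0 sM].
apply/cvgrPdist_lt => e e0; near=> y.
have Uy : U y by near: y.
apply: (le_lt_trans (sM (x, y) _)) => /=.
  by split => //; exact: nbhs_singleton.
rewrite -ltr_pdivlMl// mulrC.
by near: y; apply: (@cvgr_dist_lt _ _ _ (nbhs x) _ id) => //; rewrite divr_gt0.
Unshelve. all: by end_near. Qed.

Lemma continuous_bounded_itv (R : realType) (s : R -> R) (M : R) :
  continuous s -> exists K : R, forall u, `|u| <= M -> `|s u| <= K.
Proof.
move=> sc.
(* Using [|M|] keeps the interval nonempty for every sign of [M], as the extreme value theorem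
   requires. *)
have M0 : - `|M| <= `|M| by rewrite ge0_cp.
have [|c _ cmax] := @EVT_max R (fun u => `|s u|) (- `|M|) `|M| M0.
  by apply: continuous_subspaceT => x; apply: cvg_norm; exact: sc.
exists `|s c| => u uM; apply: cmax.
by rewrite in_itv/= -ler_norml (le_trans uM)// ler_norm.
Qed.

(** Open intervals generate the Borel sets of the line, and their preimages are open. It serves both
    the cube and the coordinates of column vectors. *)
Lemma borel_measurable_continuous (R : realType) (T : ptopologicalType)
    (h : T -> R) :
  continuous h -> measurable_fun setT (h : borel T -> R).
Proof.
move=> /continuousP hc.
apply: (measurability _ (RGenOpens.measurableE R)).
move=> _ [_ [a [b ->] <-]]; rewrite setTI.
by apply: sub_sigma_algebra; apply: hc; exact: interval_open.
Qed.

Lemma ler_coord_norm (R : realType) m n (A : 'M[R]_(m, n)) i j :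
  `|A i j| <= `|A|.
Proof.
rewrite [leRHS]mx_normrE.
exact: (le_bigmax _ (fun ij : 'I_m * 'I_n => `|A ij.1 ij.2|) (i, j)).
Qed.

(** * The network as a function of its parameters *)

Section network_facts.
Context {R : realType} {L : nat} {l : L.+1.-tuple nat}.
Implicit Types (sigma : R -> R) (th z v : 'cV[R]_(nparams l)).

(** Taking the identity as activation of the input makes [netS] one recursion for all layers. *)
Definition layer_act sigma (k : nat) : R -> R :=
  if k == 0%N then id else sigma.

Lemma layer_act_continuous sigma k :
  continuous sigma -> continuous (layer_act sigma k).
Proof. by rewrite /layer_act; case: ifP => // _ _ x; exact: cvg_id. Qed.

Lemma netS sigma th x k i : net sigma th x k.+1 i 0 =
  param th (bias_index l k.+1 i) +
  \sum_(j < width l k)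
    param th (weight_index l k.+1 i j) * layer_act sigma k (net sigma th x k j 0).
Proof.
rewrite /= !mxE; congr (_ + _); apply: eq_bigr => j _; rewrite !mxE /layer_act.
by case: ifP => // _; rewrite mxE.
Qed.

Lemma paramE th m (h : (m < nparams l)%N) : param th m = th (Ordinal h) 0.
Proof. by rewrite /param insubT. Qed.

Lemma paramD th v t m : param (th + t *: v) m = param th m + t * param v m.
Proof. by rewrite /param; case: insub => [j|]; rewrite ?mxE// mulr0 addr0. Qed.

Lemma param_cvg (z : nat -> 'cV[R]_(nparams l)) th m :
  z @ \oo --> th -> param (z n) m @[n --> \oo] --> param th m.
Proof.
move=> zth; rewrite /param; case: insub => [j|]; last exact: cvg_cst.
exact: (cvg_comp _ _ zth (@coord_continuous _ _ _ j 0 th)).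
Qed.

Lemma param_bounded (z : nat -> 'cV[R]_(nparams l)) th :
  z @ \oo --> th -> exists M : R, forall n m, `|param (z n) m| <= M.
Proof.
move=> zth.
have /pinfty_ex_gt0[M M0 zM] : bounded_fun z.
  by apply: cvg_seq_bounded; apply/cvg_ex; exists th.
exists M => n m; rewrite /param; case: insub => [j|]; last by rewrite normr0 ltW.
by rewrite (le_trans (ler_coord_norm _ _ _))// zM.
Qed.

Lemma net_measurable sigma th d (T : measurableType d)
    (X : T -> 'cV[R]_(width l 0)) :
  continuous sigma -> (forall j, measurable_fun setT (fun t => X t j 0)) ->
  forall k i, measurable_fun setT (fun t => net sigma th (X t) k i 0).
Proof.
move=> sc mX; elim=> [//|k IH] i.
under eq_fun do rewrite netS.
apply: measurable_funD; first exact: measurable_cst.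
apply: measurable_sum => j; apply: measurable_funM; first exact: measurable_cst.
apply: measurableT_comp (IH j).
by apply: continuous_measurable_fun; exact: layer_act_continuous.
Qed.

Lemma net_cvg sigma (z : nat -> 'cV[R]_(nparams l)) th x :
  continuous sigma -> z @ \oo --> th ->
  forall k i, net sigma (z n) x k i 0 @[n --> \oo] --> net sigma th x k i 0.
Proof.
move=> sc zth; elim=> [|k IH] i; first exact: cvg_cst.
rewrite netS; under eq_fun do rewrite netS.
apply: cvgD; first exact: param_cvg.
apply: cvg_big => [|j _]; first exact: add_continuous.
apply: cvgM; first exact: param_cvg.
exact: (cvg_comp _ _ (IH j) (@layer_act_continuous sigma k sc _)).
Qed.

(** Induction on the layers: a continuous activation maps the bounded range of one layer to a
    bounded set. The index type [J] is arbitrary so as to cover both a sequence of parameters and a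
    single one. *)
Lemma net_bounded sigma J T (z : J -> 'cV[R]_(nparams l))
    (X : T -> 'cV[R]_(width l 0)) :
  continuous sigma ->
  (exists M : R, forall n m, `|param (z n) m| <= M) ->
  (exists C : R, forall t j, `|X t j 0| <= C) ->
  forall k, exists K : R, forall n t i, `|net sigma (z n) (X t) k i 0| <= K.
Proof.
move=> sc [M zM] [C XC]; elim=> [|k [K IH]]; first by exists C => n; exact: XC.
have [K' sK] := continuous_bounded_itv K (@layer_act_continuous sigma k sc).
exists (M + \sum_(j < width l k) M * K') => n t i.
rewrite netS (le_trans (ler_normD _ _))// lerD//.
rewrite (le_trans (ler_norm_sum _ _ _))// ler_sum// => j _.
by rewrite normrM ler_pM// sK.
Qed.

Lemma offset_mono j k : (j <= k)%N -> (offset l j <= offset l k)%N.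
Proof.
case: j => [|j] jk; first by rewrite {1}/offset big_geq.
by rewrite /offset (big_cat_nat (n := j.+1) (p := k))//= leq_addr.
Qed.

Lemma offsetS k : (0 < k)%N ->
  offset l k.+1 = (offset l k + width l k * (width l k.-1).+1)%N.
Proof. by move=> k0; rewrite /offset big_nat_recr. Qed.

(** Together with [bias_index_offset] this shows that the hidden layers read only entries stored
    before those of layer [L]. *)
Lemma weight_index_offset k i j : (0 < k < L)%N ->
  (i < width l k)%N -> (j < width l k.-1)%N ->
  (weight_index l k i j < offset l L)%N.
Proof.
move=> /andP[k0 kL] ik jk; apply: leq_trans (offset_mono kL).
rewrite offsetS// /weight_index addnC ltn_add2l mulnS.
apply: (@leq_trans (i.+1 * width l k.-1)%N).
  by rewrite mulSn addnC ltn_add2r.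
by apply: leq_trans (leq_addl _ _); rewrite leq_mul2r ik orbT.
Qed.

Lemma bias_index_offset k i : (0 < k < L)%N ->
  (i < width l k)%N -> (bias_index l k i < offset l L)%N.
Proof.
move=> /andP[k0 kL] ik; apply: leq_trans (offset_mono kL).
by rewrite offsetS// /bias_index addnC ltn_add2l mulnS [ltnRHS]addnC ltn_add2l.
Qed.

Lemma net_eq_below sigma th z x :
  (forall m, (m < offset l L)%N -> param th m = param z m) ->
  forall k, (k < L)%N -> net sigma th x k = net sigma z x k.
Proof.
move=> thz; elim=> [//|k IH] kL; apply/matrixP => i j; rewrite ord1 !netS.
rewrite thz; last by apply: bias_index_offset => //; exact: ltn_ord.
congr (_ + _); apply: eq_bigr => m _; rewrite IH 1?ltnW//.
by rewrite thz//; apply: weight_index_offset => //; exact: ltn_ord.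
Qed.

(** Since [v] vanishes before the last layer, the output of layer [k] is the same at [z] and
    [z + t *: v], and layer [k.+1] is affine in its own weights and biases. *)
Lemma net_affine sigma z v t x :
  (forall m, (m < offset l L)%N -> param v m = 0) ->
  forall k i, (k <= L)%N -> net sigma (z + t *: v) x k i 0 =
  net sigma z x k i 0 + t * (net sigma (z + v) x k i 0 - net sigma z x k i 0).
Proof.
move=> v0 [|k] i kL; first by rewrite subrr mulr0 addr0.
have net_eq s : net sigma (z + s *: v) x k = net sigma z x k.
  by apply: net_eq_below => // m mL; rewrite paramD v0// mulr0 addr0.
(* With [z + v] as the case [t = 1], the same rewriting rules treat both endpoints. *)
have zv : z + v = z + 1 *: v by rewrite scale1r.
pose a (y : 'cV[R]_(nparams l)) := \sum_(j < width l k)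
  param y (weight_index l k.+1 i j) * layer_act sigma k (net sigma z x k j 0).
have aE s : a (z + s *: v) = a z + s * a v.
  by rewrite mulr_sumr -big_split/=; apply: eq_bigr => j _; rewrite paramD; ring.
rewrite zv !netS !net_eq -!/(a _) !aE !paramD; ring.
Qed.

Lemma net_eq_bias sigma th x k (i : 'I_(width l k)) : (0 < k)%N ->
  (forall j, (j < width l k.-1)%N -> param th (weight_index l k i j) = 0) ->
  net sigma th x k i 0 = param th (bias_index l k i).
Proof.
case: k i => [//|k] i _ w0; rewrite netS big1 ?addr0// => j _.
by rewrite w0 ?mul0r//; exact: ltn_ord.
Qed.

(** The direction subtracts the last layer of [th] and adds zero weights and the bias [xi]. *)
Lemma constant_output_direction th (xi : 'cV[R]_(width l L)) : (0 < L)%N ->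
  exists v, (forall m, (m < offset l L)%N -> param v m = 0) /\
    forall sigma x, net sigma (th + v) x L = xi.
Proof.
move=> L0; set o := (width l L * width l L.-1)%N.
(* The desired last layer, numbered from its own start: [o] weights, then the biases. The default of
   [insub] is not reached for entries of the parameter vector. *)
pose target m : R := if (m < o)%N then 0 else
  if insub (m - o)%N is Some i then xi i 0 else 0.
exists (\col_(m < nparams l)
  if (m < offset l L)%N then 0 else target (m - offset l L)%N - th m 0).
set v := \col_m _.
have L1 : (1 <= L <= L)%N by rewrite L0 leqnn.
have paramDv m : (m < nparams l)%N -> (offset l L <= m)%N ->
    param (th + v) m = target (m - offset l L)%N.
  by move=> mn om; rewrite paramE !mxE/= ltnNge om/= addrC subrK.
split=> [m mL|sigma x].
  by rewrite /param; case: insubP => // i _ im; rewrite mxE im mL.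
apply/matrixP => i j; rewrite ord1 net_eq_bias//.
  rewrite paramDv ?leq_addl ?bias_index_lt// /bias_index addnK /target.
  by rewrite -/o ltnNge leq_addr/= addKn valK.
move=> {}j jw; rewrite paramDv ?leq_addl ?weight_index_lt//.
rewrite /weight_index addnK /target ifT//.
apply: (@leq_trans (i.+1 * width l L.-1)%N).
  by rewrite mulSn addnC ltn_add2r.
by rewrite leq_mul2r ltn_ord orbT.
Qed.

End network_facts.

(** * Integrated squared errors: continuity and convexity *)

Lemma enorm_sqrE (R : realType) n (v : 'cV[R]_n) :
  enorm v ^+ 2 = \sum_i v i 0 ^+ 2.
Proof. by rewrite /enorm sqr_sqrtr// sumr_ge0// => i _; exact: sqr_ge0. Qed.

Section squared_error.
Context {d : measure_display} {T : measurableType d} {R : realType}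
  {mu : {finite_measure set T -> \bar R}} {p : nat}.
Implicit Types F G f : T -> 'cV[R]_p.

Definition coord_measurable F :=
  forall i, measurable_fun setT (fun x => F x i 0).

Lemma squared_error_measurable F f : coord_measurable F -> coord_measurable f ->
  measurable_fun setT (fun x => enorm (F x - f x) ^+ 2).
Proof.
move=> mF mf; under eq_fun do rewrite enorm_sqrE.
apply: measurable_sum => i; apply: measurable_funX.
by under eq_fun do rewrite !mxE; apply: measurable_funB.
Qed.

(** Dominated convergence. The target [f] may be unbounded, so the dominating function is built from
    the error of [G], which is integrable, and the uniform bound on [F n - G]. *)
Lemma squared_error_cvg (F : nat -> T -> 'cV[R]_p) G f (M : R) :
  (forall n, coord_measurable (F n)) -> coord_measurable G ->
  coord_measurable f ->
  (forall n x i, `|F n x i 0 - G x i 0| <= M) ->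
  (forall x i, F n x i 0 @[n --> \oo] --> G x i 0) ->
  (\int[mu]_x (enorm (G x - f x) ^+ 2)%:E < +oo)%E ->
  (\int[mu]_x (enorm (F n x - f x) ^+ 2)%:E @[n --> \oo] -->
    \int[mu]_x (enorm (G x - f x) ^+ 2)%:E)%E.
Proof.
move=> mF mG mf FGM FG intG.
(* This comes from [(r + s) ^+ 2 <= 2 * r ^+ 2 + 2 * s ^+ 2] in each coordinate, with [r] from
   [F n - G] and [s] from [G - f]. The constant summand is integrable because [mu] is finite. *)
pose g x := (\sum_(i < p) 2 * M ^+ 2 + 2 * enorm (G x - f x) ^+ 2).
have mGf := squared_error_measurable mG mf.
apply: (@dominated_cvg _ _ _ _ _ _ _ _ (EFin \o g)) => //.
- by move=> n; apply/measurable_EFinP; exact: squared_error_measurable.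
- move=> x _; apply: cvg_EFin; first exact: nearW.
  rewrite enorm_sqrE; under eq_fun do rewrite /= enorm_sqrE.
  apply: cvg_big => [|i _]; first exact: add_continuous.
  under eq_fun do rewrite !mxE; rewrite !mxE.
  by apply: cvgM; apply: cvgB => //; exact: cvg_cst.
- apply: (@integrableD _ _ _ _ _ _ (EFin \o cst _) (fun x => (2 * _)%:E)) => //.
    exact: finite_measure_integrable_cst.
  apply: (@integrableZl _ _ _ _ _ _ 2
    (fun x => (enorm (G x - f x) ^+ 2)%:E)) => //.
  apply/integrableP; split; first exact/measurable_EFinP.
  apply: le_lt_trans intG; rewrite le_eqVlt; apply/orP; left; apply/eqP.
  by apply: eq_integral => x _; rewrite gee0_abs// lee_fin sqr_ge0.
- move=> n x _; rewrite gee0_abs ?lee_fin ?sqr_ge0// /g !enorm_sqrE.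
  rewrite mulr_sumr -big_split/=; apply: ler_sum => i _; rewrite !mxE.
  set u := F n x i 0; set w := G x i 0; set y := f x i 0.
  have : (u - w) ^+ 2 <= M ^+ 2.
    rewrite -[leLHS]real_normK ?num_real// lerXn2r ?nnegrE//.
      by rewrite (le_trans _ (FGM n x i)).
    exact: FGM.
  (* The parallelogram identity for [u - w] and [w - y], whose sum is [u - y]. *)
  have := sqr_ge0 ((u - w) - (w - y)); nra.
Qed.

(** Pointwise convexity of the square, integrated. The right side is a sum with nonnegative weights,
    so it makes sense in the extended reals. *)
Lemma squared_error_convex F G f (t : R) : 0 <= t <= 1 ->
  coord_measurable F -> coord_measurable G -> coord_measurable f ->
  (\int[mu]_x (enorm (F x + t *: (G x - F x) - f x) ^+ 2)%:E <=
   (1 - t)%:E * \int[mu]_x (enorm (F x - f x) ^+ 2)%:E +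
   t%:E * \int[mu]_x (enorm (G x - f x) ^+ 2)%:E)%E.
Proof.
move=> /andP[t0 t1] mF mG mf.
have mFf := squared_error_measurable mF mf.
have mGf := squared_error_measurable mG mf.
have t1' : 0 <= 1 - t by rewrite subr_ge0.
have sq0 (h : T -> 'cV[R]_p) x : (0 <= (enorm (h x - f x) ^+ 2)%:E)%E.
  by rewrite lee_fin sqr_ge0.
rewrite -!ge0_integralZl_EFin//; do 2?[exact/measurable_EFinP].
rewrite -ge0_integralD//; first last.
- by apply/measurable_EFinP/measurable_funM => //; exact: measurable_cst.
- by move=> x _; rewrite mule_ge0.
- by apply/measurable_EFinP/measurable_funM => //; exact: measurable_cst.
- by move=> x _; rewrite mule_ge0.
apply: ge0_le_integral => //.
- by move=> x _; rewrite lee_fin sqr_ge0.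
- apply/measurable_EFinP/squared_error_measurable => // i.
  under eq_fun do rewrite !mxE; apply: measurable_funD => //.
  by apply: measurable_funM; [exact: measurable_cst|exact: measurable_funB].
- apply/measurable_EFinP/measurable_funD; apply: measurable_funM => //;
    exact: measurable_cst.
move=> x _; rewrite -!EFinM -EFinD lee_fin !enorm_sqrE !mulr_sumr -big_split/=.
apply: ler_sum => i _; rewrite !mxE.
(* This quantity is exactly the gap in the convexity inequality for the square in coordinate [i]. *)
have : 0 <= t * (1 - t) * (F x i 0 - G x i 0) ^+ 2.
  by apply: mulr_ge0; [exact: mulr_ge0|exact: sqr_ge0].
nra.
Qed.

End squared_error.

(** * From networks on the cube to continuity and directional convexity of the risk *)

Section realization_facts.
Context {R : realType} {dI dO : nat} {a b : R} {ab : a < b}.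
Context {L : nat} {l : L.+1.-tuple nat}.
Context {hI : width l 0 = dI} {hO : width l L = dO}.
Variable sigma : R -> R.
Hypothesis sigma_cont : continuous sigma.
Implicit Types (th z v : 'cV[R]_(nparams l)).

Lemma realizationE th (x : 'cV[R]_dI) i : realization hI hO sigma th x i 0 =
  net sigma th (castmx (esym hI, erefl 1%N) x) L (cast_ord (esym hO) i) 0.
Proof. by rewrite /realization castmxE cast_ord_id. Qed.

Lemma cube_val_coord_continuous i :
  continuous (fun x : cube ab dI => cube_val x i 0).
Proof.
have cv : continuous (@cube_val R a b ab dI) by exact: initial_continuous.
by move=> x; exact: (cvg_comp _ _ (cv x) (@coord_continuous _ _ _ i 0 _)).
Qed.

Lemma realization_measurable th : coord_measurable
  (fun x : borel (cube ab dI) =>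
    realization hI hO sigma th (cube_val (x : cube ab dI))).
Proof.
move=> i; under eq_fun do rewrite realizationE.
apply: net_measurable => // j; under eq_fun do rewrite castmxE cast_ord_id.
apply: (@borel_measurable_continuous R (cube ab dI)).
exact: cube_val_coord_continuous.
Qed.

Lemma realization_cvg (z : nat -> 'cV[R]_(nparams l)) th (x : 'cV[R]_dI) i :
  z @ \oo --> th ->
  realization hI hO sigma (z n) x i 0 @[n --> \oo] -->
  realization hI hO sigma th x i 0.
Proof.
move=> zth; rewrite realizationE; under eq_fun do rewrite realizationE.
exact: net_cvg.
Qed.

(** Points of the cube have entries of size at most [|a| + |b|], so the layerwise bound is uniform
    in both parameter and input. *)
Lemma realization_bounded (J : Type) (z : J -> 'cV[R]_(nparams l)) :
  (exists M : R, forall n m, `|param (z n) m| <= M) ->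
  exists K : R, forall n (x : cube ab dI) i,
    `|realization hI hO sigma (z n) (cube_val x) i 0| <= K.
Proof.
move=> zM.
have [|K HK] := net_bounded
  (X := fun x : cube ab dI => castmx (esym hI, erefl 1%N) (cube_val x))
  sigma_cont zM _ L.
  exists (`|a| + `|b|) => x j; rewrite castmxE cast_ord_id.
  have /set_mem/(_ (cast_ord (esym (esym hI)) j))/= := valP x.
  move=> /andP[ax xb]; rewrite ler_norml.
  have := ler_norm b; have := ler_norm (- a); rewrite normrN.
  have := normr_ge0 a; have := normr_ge0 b.
  move=> *; apply/andP; split; [apply: le_trans ax|apply: le_trans xb _]; lra.
by exists K => n x i; rewrite realizationE.
Qed.

Lemma realization_affine z v t (x : 'cV[R]_dI) :
  (forall m, (m < offset l L)%N -> param v m = 0) ->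
  realization hI hO sigma (z + t *: v) x = realization hI hO sigma z x +
    t *: (realization hI hO sigma (z + v) x - realization hI hO sigma z x).
Proof.
by move=> v0; apply/matrixP => i j; rewrite ord1 !mxE !realizationE net_affine.
Qed.

Context {mu : {finite_measure set (borel (cube ab dI)) -> \bar R}}.
Context {f : cube ab dI -> 'cV[R]_dO}.
Hypothesis mf : coord_measurable (f : borel (cube ab dI) -> 'cV[R]_dO).
Hypothesis risk_fin : forall th, (erisk mu f sigma hI hO th < +oo)%E.
Local Notation risk := (risk mu f sigma hI hO).

Lemma riskE th : (risk th)%:E = erisk mu f sigma hI hO th.
Proof.
rewrite fineK// ge0_fin_numE//.
by apply: integral_ge0 => x _; rewrite lee_fin sqr_ge0.
Qed.

Lemma risk_cvg (z : nat -> 'cV[R]_(nparams l)) th :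
  z @ \oo --> th -> risk (z n) @[n --> \oo] --> risk th.
Proof.
move=> zth; apply: fine_cvg; rewrite riskE.
have [K zK] := realization_bounded (param_bounded zth).
(* The limit parameter is treated as a family over [unit]; its entries are bounded because the
   constant sequence converges. The sum [K + K'] then bounds the distance between the
   realizations. *)
have [|K' thK] := @realization_bounded unit (fun=> th).
  have [M thM] := param_bounded (cvg_cst th : (fun=> th) @ \oo --> th).
  by exists M => _ m; exact: thM 0%N m.
apply: (@squared_error_cvg _ _ _ mu dO
  (fun n x => realization hI hO sigma (z n) (cube_val (x : cube ab dI)))
  (fun x => realization hI hO sigma th (cube_val (x : cube ab dI))) f (K + K')).
- by move=> n; exact: realization_measurable.
- exact: realization_measurable.
- exact: mf.
- by move=> n x i; rewrite (le_trans (ler_normB _ _))// lerD// (thK tt).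
- by move=> x i; exact: realization_cvg.
- exact: risk_fin.
Qed.

(** The realization is affine in [t] along [v], so convexity of the squared error applies;
    finiteness of the risk turns the extended inequality into a real one with a difference. *)
Lemma risk_convex z v t : 0 <= t <= 1 ->
  (forall m, (m < offset l L)%N -> param v m = 0) ->
  risk (z + t *: v) <= risk z + t * (risk (z + v) - risk z).
Proof.
move=> t01 v0.
have : (erisk mu f sigma hI hO (z + t *: v) <=
    (1 - t)%:E * erisk mu f sigma hI hO z +
    t%:E * erisk mu f sigma hI hO (z + v))%E.
  apply: le_trans (squared_error_convex (mu := mu) t01
    (realization_measurable z) (realization_measurable (z + v)) mf).
  rewrite le_eqVlt; apply/orP; left; apply/eqP.
  by apply: eq_integral => x _; rewrite realization_affine.
rewrite -!riskE; move: (risk _) (risk z) (risk (z + v)) => r0 r1 r2.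
by rewrite -!EFinM -EFinD lee_fin mulrBl mul1r mulrBr addrAC addrA.
Qed.

End realization_facts.

(** * Comparison of a critical point with constant functions *)

Unset Implicit Arguments.
Set Strict Implicit.

Theorem proposition2p10 (R : realType) (dI dO : nat)
  (dI_gt0 : (0 < dI)%N) (dO_gt0 : (0 < dO)%N)
  (a b : R) (ab : a < b)
  (sigma : R -> R) (sigma_lip : locally_lipschitz sigma)
  (mu : {finite_measure set (borel (cube ab dI)) -> \bar R})
  (f : cube ab dI -> 'cV[R]_dO)
  (mf : measurable_fun setT (f : borel (cube ab dI) -> borel 'cV[R]_dO))
  (L : nat) (L_gt0 : (0 < L)%N) (l : L.+1.-tuple nat)
  (l_gt0 : forall k : 'I_L.+1, (0 < tnth l k)%N)
  (hI : width l 0 = dI) (hO : width l L = dO)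
  (risk_fin : forall theta, (erisk mu f sigma hI hO theta < +oo)%E)
  (theta : 'cV[R]_(nparams l))
  (theta_crit : clarke_subdiff (risk mu f sigma hI hO) theta 0) :
  ((risk mu f sigma hI hO theta)%:E <=
    ereal_inf (range (fun xi : 'cV[R]_dO =>
      \int[mu]_x (enorm (f x - xi) ^+ 2)%:E)))%E.
Proof.
have sc := locally_lipschitz_continuous sigma_lip.
have mf' : coord_measurable (f : borel (cube ab dI) -> 'cV[R]_dO).
  move=> i; apply: (measurableT_comp (f := fun v : borel 'cV[R]_dO => v i 0)) mf.
  by apply: borel_measurable_continuous; exact: coord_continuous.
apply: le_ereal_inf_tmp => _ [xi _ <-].
have [v [v0 vxi]] :=
  constant_output_direction theta (castmx (esym hO, erefl 1%N) xi) L_gt0.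
have : \sum_i v i 0 * (0 : 'cV[R]_(nparams l)) i 0 <=
    risk mu f sigma hI hO (theta + v) - risk mu f sigma hI hO theta.
  apply: clarke_subdiff_le theta_crit => [w z|z t t01]; first exact: risk_cvg.
  exact: risk_convex.
(* Pairing [v] with the zero subgradient gives 0, so the risk at [theta] is at most that at
   [theta + v]. *)
rewrite big1 => [|i _]; last by rewrite mxE mulr0.
rewrite subr_ge0 -lee_fin => /le_trans; apply.
rewrite (riskE risk_fin (theta + v)) le_eqVlt; apply/orP; left; apply/eqP.
apply: eq_integral => x _; congr (_%:E).
(* The network at [theta + v] outputs [xi] everywhere; only the order of the difference inside the
   square remains to be swapped. *)
rewrite /realization vxi castmxKV !enorm_sqrE.
by apply: eq_bigr => i _; rewrite !mxE -sqrrN opprB.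
Qed.
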